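(* Let $n, N \ge 1$ be integers and let $\mathbf{S}$ be an $(nN)\times(nN)$ complex matrix partitioned into $N^2$ blocks $\mathbf{S}_{ij}$ ($1\le i,j\le N$), each of size $n\times n$: $$\mathbf{S} = \begin{bmatrix} \mathbf{S}_{11} & \mathbf{S}_{12} & \cdots & \mathbf{S}_{1N} \\ \mathbf{S}_{21} & \mathbf{S}_{22} & \cdots & \mathbf{S}_{2N} \\ \vdots & \vdots & \ddots & \vdots \\ \mathbf{S}_{N1} & \mathbf{S}_{N2} & \cdots & \mathbf{S}_{NN} \end{bmatrix}.$$ For $1\le k\le N-1$ let $\tilde{\mathbf{S}}_k$ be the $k\times k$ block matrix (of size $(nk)\times(nk)$) formed from the lower-right corner of $\mathbf{S}$, and assume that $\tilde{\mathbf{S}}_k$ is invertible for every $1\le k\le N-1$. Define $n \times n$ matrices, for $1\le i,j\le N-k$, by $$\boldsymbol{\alpha}^{(0)}_{ij} = \mathbf{S}_{ij}, \qquad \boldsymbol{\alpha}^{(k)}_{ij} = \mathbf{S}_{ij} - \boldsymbol{\sigma}^T_{i,N-k+1}\, \tilde{\mathbf{S}}_k^{-1}\, \mathbf{s}_{N-k+1,j} \quad (1\le k\le N-1),$$ where $\boldsymbol{\sigma}^T_{ij}$ and $\mathbf{s}_{ij}$ are the block row and block column vectors $$\boldsymbol{\sigma}^T_{ij} = \begin{pmatrix} \mathbf{S}_{ij} & \mathbf{S}_{i,j+1} & \cdots & \mathbf{S}_{iN}\end{pmatrix}, \qquad \mathbf{s}_{ij} = \begin{pmatrix} \mathbf{S}_{ij}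 \\ \mathbf{S}_{i+1,j} \\ \vdots \\ \mathbf{S}_{Nj}\end{pmatrix}.$$ Then $$\det(\mathbf{S}) = \prod_{k=1}^{N} \det\left(\boldsymbol{\alpha}^{(N-k)}_{kk}\right).$$
   Context: The matrix $\tilde{\mathbf{S}}_k$ is explicitly $$\tilde{\mathbf{S}}_k = \begin{bmatrix} \mathbf{S}_{N-k+1,N-k+1} & \cdots & \mathbf{S}_{N-k+1,N} \\ \vdots & \ddots & \vdots \\ \mathbf{S}_{N,N-k+1} & \cdots & \mathbf{S}_{N,N}\end{bmatrix}.$$ The block column vector $\mathbf{s}_{ij}$ is obtained by stacking the blocks $\mathbf{S}_{ij},\mathbf{S}_{i+1,j},\dots,\mathbf{S}_{Nj}$ vertically; the individual blocks are not transposed. Likewise $\boldsymbol{\sigma}^T_{ij}$ places the blocks $\mathbf{S}_{ij},\dots,\mathbf{S}_{iN}$ side by side, with no transposition of individual blocks. *)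

(* Defs.v *)
From mathcomp Require Import all_boot all_order all_algebra.
From mathcomp Require Import reals.
From mathcomp Require Export complex.

Set Implicit Arguments.
Unset Strict Implicit.
Unset Printing Implicit Defensive.

Import GRing.Theory.
Local Open Scope ring_scope.

(* Block indices are natural numbers counted from 1.  An index larger than N  *)
(* yields the zero block, and index 0 behaves like index 1; only indices      *)
(* between 1 and N are meaningful.                                            *)
Definition block (C : fieldType) (n N : nat) (S : 'M[C]_(\sum_(i < N) n))
    (i j : nat) : 'M[C]_n :=
  match insub i.-1 : option 'I_N, insub j.-1 : option 'I_N with
  | Some i', Some j' => @submxblock C N N (fun=> n) (fun=> n) S i' j'
  | _, _ => 0
  end.

(* The blocks S_ij, ..., S_iN: there are N + 1 - j of them.                   *)
Definition sigmaT (C : fieldType) (n N : nat) (S : 'M[C]_(\sum_(i < N) n))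
    (i j : nat) : 'M[C]_(n, \sum_(l < N.+1 - j) n) :=
  \mxrow_(l < N.+1 - j) block S i (j + l)%N.

Definition scol (C : fieldType) (n N : nat) (S : 'M[C]_(\sum_(i < N) n))
    (i j : nat) : 'M[C]_(\sum_(l < N.+1 - i) n, n) :=
  \mxcol_(l < N.+1 - i) block S (i + l)%N j.

(* For k <= N the number of blocks N.+1 - (N - k + 1) per side is k; it is    *)
(* written in this form so that the product with sigmaT and scol, taken at    *)
(* index N - k + 1, typechecks without casts.                                 *)
Definition Stilde (C : fieldType) (n N : nat) (S : 'M[C]_(\sum_(i < N) n))
    (k : nat) : 'M[C]_(\sum_(l < N.+1 - (N - k + 1)) n) :=
  \mxblock_(a < N.+1 - (N - k + 1), b < N.+1 - (N - k + 1))
    block S (N - k + 1 + a)%N (N - k + 1 + b)%N.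

Definition alpha (C : fieldType) (n N : nat) (S : 'M[C]_(\sum_(i < N) n))
    (k i j : nat) : 'M[C]_n :=
  if k is 0 then block S i j
  else block S i j
       - sigmaT S i (N - k + 1)%N *m invmx (Stilde S k)
           *m scol S (N - k + 1)%N j.

(* Main.v *)
Require Import Defs.
From mathcomp Require Import all_boot all_order all_algebra.
From mathcomp Require Import reals.
Import GRing.Theory.
Local Open Scope ring_scope.

(* The Schur complement formula, applied to the lower-right corner of S made  *)
(* of the blocks of index at least p, splits off the single block (p, p) and  *)
(* gives det(corner_p) = det(alpha^(N-p)_pp) det(corner_(p+1)), because       *)
(* alpha^(N-p)_pp is the Schur complement of corner_(p+1) in corner_p.        *)
(* Iterating from p = 1 down to the empty corner yields the product.          *)

(** The recursion rests on [det_block_mx_schur] and becomes [det_corner_recl]; [det_corner_prod]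
    telescopes it. The assumed invertible matrices are the corners with 1 < p <= N, and the empty
    corner, of determinant 1, is invertible for free. *)

Section BlockSchur.
Variable C : fieldType.

Lemma det_mx_size0 d (A : 'M[C]_d) : d = 0%N -> \det A = 1.
Proof. by move=> d0; subst d; exact: det_mx00. Qed.

Lemma det_castmx d1 d2 (e : d1 = d2) (A : 'M[C]_d1) :
  \det (castmx (e, e) A) = \det A.
Proof. by case: d2 / e; rewrite castmx_id. Qed.

(** Block elimination: a unipotent upper triangular factor, of determinant 1, clears [Aur] and
    leaves a lower triangular matrix. *)
Lemma det_block_mx_schur d1 d2 (Aul : 'M[C]_d1) (Aur : 'M_(d1, d2)) Adl Adr :
    Adr \in unitmx ->
  \det (block_mx Aul Aur Adl Adr)
    = \det (Aul - Aur *m invmx Adr *m Adl) * \det Adr.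
Proof.
move=> uA.
have -> : block_mx Aul Aur Adl Adr
    = block_mx 1%:M (Aur *m invmx Adr) 0 1%:M
      *m block_mx (Aul - Aur *m invmx Adr *m Adl) 0 Adl Adr.
  by rewrite mulmx_block !mul1mx !mul0mx !add0r subrK mulmxKV.
by rewrite det_mulmx det_ublock !det1 !mul1r det_lblock.
Qed.

(* Blocks are indexed by nat rather than by ordinals, so that the number m of *)
(* blocks can be rewritten without casts.                                     *)
Lemma det_mxblock_recul n m (f : nat -> nat -> 'M[C]_n) :
    \mxblock_(a < m, b < m) f a.+1 b.+1 \in unitmx ->
  \det (\mxblock_(a < m.+1, b < m.+1) f a b)
    = \det (f 0%N 0%N
            - \mxrow_(l < m) f 0%N l.+1
              *m invmx (\mxblock_(a < m, b < m) f a.+1 b.+1)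
              *m \mxcol_(l < m) f l.+1 0%N)
      * \det (\mxblock_(a < m, b < m) f a.+1 b.+1).
Proof.
move=> uf; rewrite mxblock_recul det_castmx.
exact: det_block_mx_schur.
Qed.

Section Corners.
Variables (n N : nat) (S : 'M[C]_(\sum_(i < N) n)).

Definition corner p :=
  \mxblock_(a < N.+1 - p, b < N.+1 - p) block S (p + a)%N (p + b)%N.

Lemma Stilde_corner k : Stilde S k = corner (N - k + 1).
Proof. by []. Qed.

Lemma det_corner_last : \det (corner N.+1) = 1.
Proof. by apply: det_mx_size0; rewrite subnn big_ord0. Qed.

Lemma det_corner1 : \det (corner 1) = \det S.
Proof.
have -> : \det (corner 1)
    = \det (\mxblock_(a < N, b < N) block S (1 + a)%N (1 + b)%N).
  by rewrite /corner subn1.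
rewrite -[in RHS](submxblockK S); congr (\det _).
apply: eq_mxblock => i j; rewrite /block !add1n /=.
by rewrite !valK.
Qed.

(** This absorbs the case k = 0 of [alpha]: for p = N the corner is empty and the correction term
    vanishes. *)
Lemma alpha_schur p : (1 <= p <= N)%N ->
  alpha S (N - p) p p
    = block S p p - sigmaT S p p.+1 *m invmx (corner p.+1) *m scol S p.+1 p.
Proof.
case/andP=> p0; rewrite leq_eqVlt => /orP[/eqP->|ltpN].
  rewrite subnn /= -[LHS]subr0; congr (_ - _).
  apply/matrixP=> i j; rewrite !mxE big1 // => l.
  by exfalso; move: l; rewrite subnn big_ord0 => -[].
have -> : alpha S (N - p) p p
    = block S p p - sigmaT S p (N - (N - p) + 1)%N
      *m invmx (corner (N - (N - p) + 1)) *m scol S (N - (N - p) + 1)%N p.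
  by rewrite -subn_gt0 in ltpN; case: (N - p)%N ltpN.
by rewrite subKn ?(ltnW ltpN) // addn1.
Qed.

Lemma det_corner_recl p : (1 <= p <= N)%N -> corner p.+1 \in unitmx ->
  \det (corner p) = \det (alpha S (N - p) p p) * \det (corner p.+1).
Proof.
move=> hp; rewrite (alpha_schur p hp); case/andP: hp => _ lepN.
(* Counting indices from p gives the shape required by [det_mxblock_recul]. *)
pose f a b := block S (p + a)%N (p + b)%N.
have cornerE : corner p.+1
    = \mxblock_(a < N.+1 - p.+1, b < N.+1 - p.+1) f a.+1 b.+1.
  by apply: eq_mxblock => a b; rewrite /f -!addSnnS.
have sigmaE : sigmaT S p p.+1 = \mxrow_(l < N.+1 - p.+1) f 0%N l.+1.
  by apply: eq_mxrow => l; rewrite /f -addSnnS addn0.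
have scolE : scol S p.+1 p = \mxcol_(l < N.+1 - p.+1) f l.+1 0%N.
  by apply: eq_mxcol => l; rewrite /f -addSnnS addn0.
rewrite cornerE sigmaE scolE => /det_mxblock_recul; rewrite /f !addn0 => <-.
by rewrite /corner subSS subSn.
Qed.

Lemma det_corner_prod :
    (forall p, (1 < p <= N)%N -> corner p \in unitmx) ->
  forall p, (1 <= p <= N.+1)%N ->
  \det (corner p) = \prod_(p <= k < N.+1) \det (alpha S (N - k) k k).
Proof.
move=> uc p /andP[p0 lepN1].
have [d pE] : exists d, (p + d = N.+1)%N by exists (N.+1 - p)%N; rewrite subnKC.
(* Descending induction on p: d is its distance to the empty corner. *)
elim: d p p0 pE {lepN1} => [|d IHd] p p0 pE.
  by rewrite -(addn0 p) pE big_geq ?det_corner_last.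
have lepN : (p <= N)%N by rewrite -ltnS -pE -addSnnS leq_addr.
rewrite big_ltn // -IHd ?addSnnS // det_corner_recl ?p0 //.
(* For p = N the next corner is the empty one, which [uc] does not cover. *)
move: lepN; rewrite leq_eqVlt => /orP[/eqP->|ltpN].
  by rewrite unitmxE det_corner_last unitr1.
by apply: uc; rewrite ltnS p0.
Qed.

End Corners.
End BlockSchur.

Theorem theorem2p1 (R : realType) (n N : nat) (hn : (1 <= n)%N)
    (hN : (1 <= N)%N) (S : 'M[R[i]]_(\sum_(i < N) n))
    (hS : forall k : nat, (1 <= k <= N - 1)%N -> Stilde S k \in unitmx) :
  \det S = \prod_(1 <= k < N.+1) \det (alpha S (N - k) k k).
Proof.
rewrite -det_corner1 det_corner_prod // => p /andP[lt1p lepN].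
(* With k = N + 1 - p, the matrix [Stilde S k] is the corner starting at p. *)
have /hS : (1 <= N.+1 - p <= N - 1)%N.
  by rewrite subn_gt0 ltnS lepN -(subSS 1) leq_sub2l.
have pE : (N - (N.+1 - p) + 1 = p)%N.
  rewrite addn1 -subSn ?subKn ?(leqW lepN) //.
  by rewrite leq_subLR -add1n leq_add2r ltnW.
by rewrite Stilde_corner pE.
Qed.
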